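(* Let $[u,v]$, $[v,w]$ be Bruhat intervals in $S_n$ with chains $\mathcal C_1$ (from $u$ to $v$) and $\mathcal C_2$ (from $v$ to $w$) such that $\mathcal N_{u,v}$ and $\mathcal N_{v,w}$ are toric. Then $\mathcal N_{u,w}$ is toric if and only if there exist no vertices $a_1,\dots,a_{2k}\in[n]$, components $B_1,\dots,B_k$ of $G_{\mathcal C_1}$ and components $C_1,\dots,C_k$ of $G_{\mathcal C_2}$ such that \begin{align*} &a_1\in V(B_1)\cap V(C_1),\quad a_2\in V(C_1)\cap V(B_2),\quad a_3\in V(B_2)\cap V(C_2),\ \dots,\\ &a_{2k-1}\in V(B_k)\cap V(C_k),\quad a_{2k}\in V(C_k)\cap V(B_1). \end{align*}
   Context: $\le$ is the Bruhat order on $S_n$; for $x\le y$ the Bruhat interval is $[x,y]=\{z\in S_n: x\le z\le y\}$. $\ell$ is the Coxeter length, $x\lessdot y$ means $x<y$ and $\ell(y)=\ell(x)+1$, and $t_{a,b}$ is the transposition of $a$ and $b$. For a chain $\mathcal C: x=u_0\lessdot u_1\lessdot\cdots\lessdot u_l=y$, the undirected graph $G_{\mathcal C}$ has vertex set $[n]=\{1,\dots,n\}$ and an edge $(a,b)$ if and only if $u_{i+1}=u_it_{a,b}$ for some $0\le i\le l-1$. Components are connected components, and $V(\cdot)$ denotes the vertex set. Let $B$ (resp. $B_-$) be the upper (resp. lower) triangular Borel subgroup of $G=GL_n(\mathbb C)$ and $T$ the diagonal torus. For $v\le w$ the Kazhdan-Lusztig variety is $\mathcal N_{v,w}=\overline{BwB/B}\cap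 B_-vB/B\subset G/B$; its dimension is $\ell(w)-\ell(v)$. The usual torus action is the action of $T$ by left multiplication. With $D^\circ(v)=\{(i,j): v(j)<i,\ v^{-1}(i)>j\}$, its weight cone is $\sigma_{v,w}=\mathrm{Cone}(e_{v(j)}-e_i : (i,j)\in D^\circ(v),\ t_{v(j),i}\,v\le w)\subset\mathbb R^n$, where $e_1,\dots,e_n$ is the standard basis. The complexity of $\mathcal N_{v,w}$ is $\dim\mathcal N_{v,w}-\dim\sigma_{v,w}$, and $\mathcal N_{v,w}$ is called toric if its complexity is $0$.
   Formalization: The vertices a_1,…,a_{2k} are required to be pairwise distinct and k ≥ 1; without this, k = 1 with a_1 = a_2 always satisfies the condition and the claim fails, e.g. for u = v = w. *)

(* Defs.v *)
From mathcomp Require Import all_boot all_order all_fingroup all_algebra.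
From mathcomp Require Import boolp classical_sets reals.

Set Implicit Arguments.
Unset Strict Implicit.
Unset Printing Implicit Defensive.

Import GRing.Theory Num.Theory.
Local Open Scope ring_scope.

(* [n] is 'I_n, i.e. indices are shifted to {0, ..., n-1}.  MathComp composes
   permutations left to right: (s * t)%g x = t (s x).  Hence the product
   written u t_{a,b} in the usual right-to-left convention is (tperm a b * u)%g,
   and t_{c,d} v is (v * tperm c d)%g. *)

Section Bruhat.
Variable n : nat.
Implicit Types (u v w x y : 'S_n).

Definition simple_refl : {set 'S_n} :=
  [set s | [exists i : 'I_n, exists j : 'I_n,
              (val j == (val i).+1) && (s == tperm i j)]].

Definition has_word w (k : nat) : bool :=
  [exists c : {ffun 'I_k -> 'S_n},
     [forall i, c i \in simple_refl] && (w == (\prod_(i < k) c i)%g)].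

Lemma tperm_simple (d : nat) (i j : 'I_n) :
  val j = (val i + d)%N -> tperm i j \in <<simple_refl>>%g.
Proof.
elim: d j => [|d IHd] j jE.
  have -> : j = i by apply: val_inj; rewrite jE addn0.
  by rewrite tperm1 group1.
have ltk : (val i + d < n)%N.
  by rewrite (leq_trans _ (ltn_ord j)) // jE addnS.
pose k := Ordinal ltk.
have kj : tperm k j \in <<simple_refl>>%g.
  apply/mem_gen; rewrite inE; apply/existsP; exists k; apply/existsP; exists j.
  by rewrite eqxx andbT jE addnS.
have [-> //|ik] := eqVneq i k.
have ij : i != j.
  apply/eqP => /(congr1 val) /eqP.
  by rewrite jE -[X in X == _]addn0 eqn_add2l.
have -> : tperm i j = (tperm i k ^ tperm k j)%g.
  rewrite tpermJ tpermL tpermD // eq_sym //.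
by rewrite groupJ // IHd.
Qed.

Lemma has_word_ex w : exists k, has_word w k.
Proof.
have : w \in <<simple_refl>>%g.
  have [ts -> _] := prod_tpermP w.
  apply: group_prod => -[i j] _ /=.
  have [le|/ltnW le] := leqP (val i) (val j).
    by apply: (@tperm_simple (val j - val i)); rewrite subnKC.
  by rewrite tpermC; apply: (@tperm_simple (val i - val j)); rewrite subnKC.
case/gen_prodgP => k [c cS ->]; exists k; apply/existsP; exists (finfun c).
apply/andP; split; first by apply/forallP => i; rewrite ffunE.
by apply/eqP/eq_bigr => i _; rewrite ffunE.
Qed.

Definition coxeter_length w : nat := ex_minn (has_word_ex w).

Definition bruhat_step x y : bool :=
  [exists a : 'I_n, exists b : 'I_n, y == (tperm a b * x)%g]
  && (coxeter_length x < coxeter_length y)%N.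

Definition bruhat_le x y : bool := connect bruhat_step x y.

Definition bruhat_lt x y : bool := (x != y) && bruhat_le x y.

Definition bruhat_cover x y : bool :=
  bruhat_lt x y && (coxeter_length y == (coxeter_length x).+1).

(* The chain x = u_0, u_1, ..., u_l = y is represented by its starting point x
   and the sequence c = [:: u_1; ...; u_l]. *)
Definition is_chain x y (c : seq 'S_n) : bool :=
  path bruhat_cover x c && (last x c == y).

Definition chain_edge x (c : seq 'S_n) : rel 'I_n := fun a b =>
  [exists i : 'I_(size c),
     nth x (x :: c) i.+1 == (tperm a b * nth x (x :: c) i)%g].

(* A connected component is identified with its vertex set; isolated vertices
   form singleton components. *)
Definition components (e : rel 'I_n) : {set {set 'I_n}} :=
  equivalence_partition (connect e) [set: 'I_n].

End Bruhat.

Section Cones.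
Variables (R : realType) (n : nat).
Local Open Scope classical_set_scope.

Definition std_basis (i : 'I_n) : 'rV[R]_n := delta_mx 0 i.

Definition cone (s : seq 'rV[R]_n) : set 'rV[R]_n :=
  [set x | exists c : 'I_(size s) -> R,
     (forall i, 0 <= c i) /\ x = \sum_(i < size s) c i *: s`_i].

Definition in_subspace_dim (A : set 'rV[R]_n) (d : nat) : bool :=
  `[< exists U : {vspace 'rV[R]_n}, (forall x, A x -> x \in U) /\ \dim U = d >].

Lemma in_subspace_dim_ex (A : set 'rV[R]_n) : exists d, in_subspace_dim A d.
Proof.
exists (\dim {:'rV[R]_n}); apply/asboolP; exists fullv.
by split=> // x _; rewrite memvf.
Qed.

(* The dimension of the smallest linear subspace containing the cone. *)
Definition cone_dim (A : set 'rV[R]_n) : nat := ex_minn (in_subspace_dim_ex A).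

End Cones.

Section KazhdanLusztig.
Variables (R : realType) (n : nat).
Implicit Types v w : 'S_n.

Definition opposite_diagram v : {set 'I_n * 'I_n} :=
  [set p : 'I_n * 'I_n | (v p.2 < p.1)%N && (p.2 < (v^-1)%g p.1)%N].

Definition weight_cone v w : set 'rV[R]_n :=
  cone [seq std_basis R (v p.2) - std_basis R p.1
       | p <- enum (opposite_diagram v)
       & bruhat_le (v * tperm (v p.2) p.1)%g w].

(* The dimension l(w) - l(v) of the variety N_{v,w}, for v <= w. *)
Definition KL_dim v w : int :=
  (coxeter_length w)%:Z - (coxeter_length v)%:Z.

Definition KL_complexity v w : int :=
  KL_dim v w - (cone_dim (weight_cone v w))%:Z.

Definition KL_toric v w : Prop := KL_complexity v w = 0.

End KazhdanLusztig.

(* The 0-based entries a (2 i), a (2 i).+1, B i, C i stand for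
   a_{2i+1}, a_{2i+2}, B_{i+1}, C_{i+1}; the index of B is cyclic modulo k.
   The a's are pairwise distinct: otherwise k = 1 and a_1 = a_2 would always be
   a solution.  Given this, requiring the B's and the C's to be distinct would
   not change whether a solution exists, since a closed walk with distinct
   edges in a bipartite multigraph contains a cycle. *)
Definition alternating_cycle (n : nat) (e1 e2 : rel 'I_n) : Prop :=
  exists (k : nat) (a : nat -> 'I_n) (B C : nat -> {set 'I_n}),
  [/\ (0 < k)%N,
      (forall i j, (i < 2 * k)%N -> (j < 2 * k)%N -> a i = a j -> i = j),
      (forall i, (i < k)%N -> B i \in components e1 /\ C i \in components e2)
    & (forall i, (i < k)%N ->
         a (2 * i)%N \in B i :&: C i /\
         a (2 * i).+1 \in C i :&: B (i.+1 %% k)%N)].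

(* Main.v *)
(* Label each step x -> x t_{a,b} of a saturated chain by the pair (a, b) and
   attach to it the vector e_a - e_b. The span V of these vectors depends only on
   the end points of the chain: replacing two consecutive steps by the other pair
   of steps of the same length-2 interval does not change V, these replacements
   turn any chain into a lexicographically increasing one, and that one is
   unique. By another use of length-2 intervals, V is also the span of all
   e_a - e_b with x < x t_{a,b} <= y, which is the span of the weight cone up to
   a permutation of coordinates. So N_{x,y} is toric iff the vectors along one
   (equivalently any) chain are linearly independent.
   Hence, with V1 and V2 the spans for C1 and C2, N_{u,w} is toric iff
   V1 :&: V2 = 0. A vector lies in V1 only if its coordinates sum to 0 over each
   component of G_{C1}. An alternating cycle gives the nonzero vector
   \sum_i (-1)^i e_{a_i} of V1 :&: V2; conversely, in the support of a nonzero
   vector of V1 :&: V2 every vertex has another support vertex in its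
   component, for both graphs, so one can walk alternately until a vertex
   repeats. *)
Require Import Defs.
From mathcomp Require Import all_boot all_order all_fingroup all_algebra.
From mathcomp Require Import boolp classical_sets reals.
From mathcomp Require Import zify.

Set Implicit Arguments.
Unset Strict Implicit.
Unset Printing Implicit Defensive.

Import GRing.Theory Num.Theory.
Local Open Scope ring_scope.

(** * Saturated chains and their labels *)

Section BruhatChains.
Variable n : nat.
Implicit Types (x y z w : 'S_n) (p q : 'I_n * 'I_n) (ls : seq ('I_n * 'I_n)).

Local Notation len := (@coxeter_length n).

(** * Words in simple reflections and the length function *)

Lemma has_word0 w : has_word w 0 = (w == 1%g).
Proof.
apply/existsP/eqP => [[c /andP[_ /eqP->]]|->]; first by rewrite big_ord0.
exists [ffun=> 1%g]; rewrite big_ord0 eqxx andbT.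
by apply/forallP => -[].
Qed.

Lemma has_wordS w k : has_word w k.+1 <->
  exists w' s, [/\ has_word w' k, s \in simple_refl n & w = (w' * s)%g].
Proof.
split=> [/existsP[c /andP[/forallP cS /eqP wE]]|[w' [s [/existsP[c]]]]].
  exists (\prod_(i < k) c (widen_ord (leqnSn k) i))%g, (c ord_max).
  split=> //; last by rewrite wE big_ord_recr.
  apply/existsP; exists [ffun i => c (widen_ord (leqnSn k) i)].
  apply/andP; split; first by apply/forallP => i; rewrite ffunE.
  by apply/eqP/eq_bigr => i _; rewrite ffunE.
case/andP=> /forallP cS /eqP -> sS ->; apply/existsP.
exists [ffun i : 'I_k.+1 => if unlift ord_max i is Some j then c j else s].
apply/andP; split.
  by apply/forallP => i; rewrite ffunE; case: (unlift _ i).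
apply/eqP; rewrite big_ord_recr /= ffunE unlift_none; congr (_ * _)%g.
apply: eq_bigr => i _; rewrite ffunE.
have -> : widen_ord (leqnSn k) i = lift ord_max i.
  by apply: val_inj; rewrite /= /bump leqNgt ltn_ord.
by rewrite liftK.
Qed.

Lemma tpermE (a b c : 'I_n) :
  tperm a b c = if c == a then b else if c == b then a else c.
Proof.
case: tpermP => [->|->|/eqP/negPf-> /eqP/negPf-> //]; rewrite eqxx //.
by case: eqP.
Qed.

(* Strong exchange: the letter that creates the inversion can be deleted. *)
Lemma has_word_exchange k w (a b : 'I_n) :
  has_word w k -> (a < b)%N -> (w b < w a)%N ->
  exists2 k', (k' < k)%N & has_word (tperm a b * w)%g k'.
Proof.
elim: k w => [|k IHk] w.
  by rewrite has_word0 => /eqP->; rewrite !perm1 => ab /(ltn_trans ab); rewrite ltnn.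
case/has_wordS => w' [s [w'k sS ->]] ab; rewrite !permM => inv.
have [inv'|ninv] := ltnP (w' b) (w' a).
  have [k' k'k wk'] := IHk _ w'k ab inv'; exists k'.+1 => //.
  by apply/has_wordS; exists (tperm a b * w')%g, s; rewrite mulgA.
exists k => //.
have neq : w' a != w' b :> nat.
  by rewrite (inj_eq val_inj) (inj_eq perm_inj) -(inj_eq val_inj) ltn_eqF.
move: sS; rewrite inE => /existsP[i /existsP[j /andP[/eqP ji /eqP sE]]].
have [wa wb] : w' a = i /\ w' b = j.
  suff: (w' a = i :> nat) /\ (w' b = j :> nat) by case=> /val_inj-> /val_inj->.
  move: inv; rewrite sE !tpermE -!(inj_eq val_inj) /=.
  by move: ji => /=; do 4?case: eqP; lia.
suff -> : (tperm a b * (w' * s) = w')%g by [].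
apply/permP => c; rewrite !permM sE -wa -wb.
case: (tpermP a b c) => [->|->|/eqP ca /eqP cb]; rewrite ?tpermL ?tpermR //.
by rewrite tpermD // (inj_eq perm_inj) eq_sym.
Qed.

Definition refl p : 'S_n := tperm p.1 p.2.

(** Ordering the two positions gives each reflection a single label; the second inequality says that
    the reflection creates an inversion, which is the same as raising the length. *)
Definition up x p : bool := (p.1 < p.2)%N && (x p.1 < x p.2)%N.

Lemma has_word_length w : has_word w (len w).
Proof. by rewrite /coxeter_length; case: ex_minnP. Qed.

Lemma length_le_word w k : has_word w k -> (len w <= k)%N.
Proof. by rewrite /coxeter_length; case: ex_minnP => m _; apply. Qed.

Lemma reflK p x : (refl p * (refl p * x) = x)%g.
Proof. by rewrite mulgA tperm2 mul1g. Qed.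

Lemma length_down x (a b : 'I_n) : (a < b)%N -> (x b < x a)%N ->
  (len (tperm a b * x)%g < len x)%N.
Proof.
move=> ab inv; have [k kl /length_le_word le] :=
  has_word_exchange (has_word_length x) ab inv.
exact: leq_ltn_trans le kl.
Qed.

Lemma length_up x p : up x p -> (len x < len (refl p * x)%g)%N.
Proof.
case/andP=> lt xlt; rewrite -[X in (len X < _)%N](reflK p).
by apply: length_down => //; rewrite !permM tpermL tpermR.
Qed.

Lemma bruhat_stepP x y :
  reflect (exists2 p, up x p & y = (refl p * x)%g) (bruhat_step x y).
Proof.
apply: (iffP andP) => [[/existsP[a /existsP[b /eqP yE]]]|[p upp ->]].
  wlog: a b yE / (a <= b)%N => [IH|].
    case/orP: (leq_total a b) => [|le]; first exact: IH.
    by apply: (IH b a); rewrite // tpermC.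
  rewrite leq_eqVlt => /orP[/eqP/val_inj ab|ab].
    by rewrite yE ab tperm1 mul1g ltnn.
  move=> lt; exists (a, b) => //; apply/andP; split=> //=.
  rewrite ltnNge leq_eqVlt; apply/norP; split.
    by rewrite (inj_eq val_inj) (inj_eq perm_inj) -(inj_eq val_inj) gtn_eqF.
  by apply/negP => /(length_down ab); rewrite -yE ltnNge ltnW.
split; last exact: length_up.
by apply/existsP; exists p.1; apply/existsP; exists p.2.
Qed.

(* The sequence of labels [:: p_1; ...; p_l] encodes the saturated chain
   x, x t_{p_1}, x t_{p_1} t_{p_2}, ... in right-to-left notation. *)
Fixpoint covers x ls : bool :=
  if ls is p :: ls' then
    [&& up x p, len (refl p * x)%g == (len x).+1 & covers (refl p * x)%g ls']
  else true.

Definition chain_end x ls : 'S_n := foldl (fun z p => (refl p * z)%g) x ls.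

Lemma length_chain_end x ls :
  covers x ls -> len (chain_end x ls) = (len x + size ls)%N.
Proof.
elim: ls x => [|p ls IH] x /=; first by rewrite addn0.
by case/and3P=> _ /eqP e /IH->; rewrite e addSnnS.
Qed.

Lemma covers_cat x ls1 ls2 :
  covers x (ls1 ++ ls2) = covers x ls1 && covers (chain_end x ls1) ls2.
Proof. by elim: ls1 x => //= p ls IH x; rewrite IH -!andbA. Qed.

Lemma chain_end_cat x ls1 ls2 :
  chain_end x (ls1 ++ ls2) = chain_end (chain_end x ls1) ls2.
Proof. exact: foldl_cat. Qed.

(* On three positions whose values increase, 321 is reached from 123 through
   213 and 312. *)
Lemma length_between x p (c : 'I_n) :
  (p.1 < c < p.2)%N -> (x p.1 < x c < x p.2)%N ->
  [/\ up x (p.1, c), up (refl (p.1, c) * x)%g p,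
      up (refl p * (refl (p.1, c) * x))%g (c, p.2)
    & (refl (c, p.2) * (refl p * (refl (p.1, c) * x)) = refl p * x)%g].
Proof.
case: p => a b /= /andP[ac cb] /andP[xac xcb].
have nac : a != c by rewrite -(inj_eq val_inj) ltn_eqF.
have ncb : c != b by rewrite -(inj_eq val_inj) ltn_eqF.
have nab : a != b by rewrite -(inj_eq val_inj) ltn_eqF // (ltn_trans ac).
rewrite /up /refl /= ac cb xac (ltn_trans ac cb) !permM tpermL tpermR /=.
split=> //.
- by rewrite tpermD.
- by rewrite (@tpermD _ a b c) ?tpermR ?tpermL // eq_sym.
apply/permP => i; rewrite !permM; congr (x _).
case: (tpermP c b i) => [->|->|/eqP ic /eqP ib].
- by rewrite tpermR tpermL tpermD // eq_sym.
- by rewrite (@tpermD _ a b c) ?tpermR // eq_sym.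
have [->|ia] := eqVneq i a; first by rewrite !tpermL tpermD // eq_sym.
by rewrite !tpermD // eq_sym.
Qed.

(** A value strictly in between would factor the step into three length-increasing ones, a jump of
    at least three. *)
Lemma cover_empty x p (c : 'I_n) : len (refl p * x)%g = (len x).+1 ->
  (p.1 < c < p.2)%N -> ~~ (x p.1 < x c < x p.2)%N.
Proof.
move=> e pc; apply/negP => /(length_between pc)[/length_up u1 /length_up u2].
by move=> /length_up u3 E; rewrite E in u3; lia.
Qed.

(** [has_wordS] splits off the last letter, whereas adjacent transpositions of positions multiply on
    the other side. *)
Lemma has_word_consl x s k :
  s \in simple_refl n -> has_word x k -> has_word (s * x)%g k.+1.
Proof.
move=> sS; elim: k x => [|k IH] x.
  rewrite has_word0 => /eqP->; apply/has_wordS; exists 1%g, s.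
  by rewrite has_word0 mulg1 mul1g.
case/has_wordS => x' [t [/IH w' tS ->]].
by apply/has_wordS; exists (s * x')%g, t; rewrite mulgA.
Qed.

Lemma length_adjacent x (a c : 'I_n) : val c = (val a).+1 ->
  (len (tperm a c * x)%g <= (len x).+1)%N.
Proof.
move=> ca; apply: length_le_word; apply: has_word_consl (has_word_length x).
by rewrite inE; apply/existsP; exists a; apply/existsP; exists c; rewrite ca !eqxx.
Qed.

(* Induction on p.2 - p.1, conjugating by the adjacent transposition at p.1. *)
Lemma empty_cover x p : up x p ->
  (forall c : 'I_n, (p.1 < c < p.2)%N -> ~~ (x p.1 < x c < x p.2)%N) ->
  len (refl p * x)%g = (len x).+1.
Proof.
case: p => a b upp nob; apply/eqP; rewrite eqn_leq (length_up upp) andbT.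
move: upp nob; rewrite /up /refl /= => /andP[ab xab].
move eqd : (b - a)%N => d; elim/ltn_ind: d a x ab xab eqd => d IH a x ab xab eqd nob.
have [e|ne] := eqVneq (val b) (val a).+1; first exact: length_adjacent.
have ltc : (a.+1 < b)%N by move/eqP: ne => /=; lia.
pose c := Ordinal (ltn_trans ltc (ltn_ord b)).
have cE : val c = (val a).+1 by [].
have [nac ncb nab] : [/\ a != c, c != b & a != b].
  by rewrite -!(inj_eq val_inj) /=; split; apply/eqP; lia.
have conj : (tperm a b * x = tperm a c * (tperm c b * (tperm a c * x)))%g.
  rewrite !mulgA; congr (_ * x)%g; rewrite -[LHS]mulg1 -(tperm2 a c) !mulgA.
  have -> : tperm c b = (tperm a b ^ tperm a c)%g.
    by rewrite tpermJ tpermL tpermD // eq_sym.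
  by rewrite /conjg tpermV !mulgA tperm2 mul1g.
have x'c : (tperm a c * x)%g c = x a by rewrite permM tpermR.
have x'b : (tperm a c * x)%g b = x b by rewrite permM tpermD.
have IHc : (len (tperm c b * (tperm a c * x))%g <= (len (tperm a c * x)%g).+1)%N.
  apply: (IH (b - c)%N) => //; rewrite ?x'c ?x'b //=; first by lia.
  move=> e /andP[ce eb]; rewrite permM tpermD; first by apply: nob; lia.
    by rewrite -(inj_eq val_inj) /=; apply/eqP; lia.
  by rewrite -(inj_eq val_inj) /=; apply/eqP; lia.
(* If [x c < x a], the inner [tperm a c] lowers the length, which pays for the outer one. *)
have [xca|xac] := ltnP (x c) (x a).
  rewrite conj; apply: leq_trans (length_adjacent _ cE) _; rewrite ltnS.
  by apply: leq_trans IHc _; apply: length_down.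
have xac' : x a != x c :> nat by rewrite (inj_eq val_inj) (inj_eq perm_inj).
have xbc : (x b < x c)%N.
  have := nob c; rewrite !ltn_neqAle; rewrite xac xac' /=.
  have xcb : x c != x b :> nat by rewrite (inj_eq val_inj) (inj_eq perm_inj).
  by move/eqP: xcb; lia.
(* Here [x b < x c], so multiplying [tperm a b * x] by [tperm a c] raises the length; the result is
   [tperm c b * (tperm a c * x)], of length at most [len x + 2]. *)
have : (len (tperm a b * x)%g < len (tperm a c * (tperm a b * x))%g)%N.
  apply: (@length_up _ (a, c)); rewrite /up /= !permM tpermL tpermD // 1?eq_sym //.
  by rewrite xbc andbT.
rewrite [in X in (_ < X)%N]conj mulgA tperm2 mul1g => lt.
rewrite -ltnS.
by apply: leq_trans lt (leq_trans IHc _); rewrite ltnS; apply: length_adjacent.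
Qed.

(** A step with no intermediate value is a cover; any other step splits by [length_between] into
    three steps with smaller length jumps. *)
Lemma up_covers x p : up x p ->
  exists2 ls, covers x ls & chain_end x ls = (refl p * x)%g.
Proof.
move eqd : (len (refl p * x)%g - len x)%N => d.
elim/ltn_ind: d x p eqd => d IH x p eqd upp; have ltp := length_up upp.
have [/existsP[c /andP[pc xc]]|/existsPn no] :=
  boolP [exists c : 'I_n, (p.1 < c < p.2)%N && (x p.1 < x c < x p.2)%N]; last first.
  exists [:: p] => //=; rewrite upp (empty_cover upp) ?eqxx // => c pc.
  by have := no c; rewrite pc.
have [u1 u2 u3 E] := length_between pc xc.
have [l1 l2 l3] := And3 (length_up u1) (length_up u2) (length_up u3).
rewrite E in l3.
have [|ls1 c1 e1] := IH _ _ _ _ erefl u1; first by lia.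
have [|ls2 c2 e2] := IH _ _ _ _ erefl u2; first by lia.
have [|ls3 c3 e3] := IH _ _ _ _ erefl u3; first by rewrite E; lia.
exists (ls1 ++ ls2 ++ ls3).
  by rewrite !covers_cat c1 e1 c2 e2 c3.
by rewrite !chain_end_cat e1 e2 e3.
Qed.

Lemma bruhat_leP x y :
  reflect (exists2 ls, covers x ls & chain_end x ls = y) (bruhat_le x y).
Proof.
apply: (iffP connectP) => [[c cp ->]|[ls]].
  elim: c x cp => [|z c IH] x /=; first by exists [::].
  case/andP=> /bruhat_stepP[p /up_covers[ls1 c1 e1] zE] /IH[ls2 c2 e2].
  by exists (ls1 ++ ls2); rewrite ?covers_cat ?chain_end_cat e1 -zE ?c1.
elim: ls x => [|p ls IH] x /=; first by move=> _ <-; exists [::].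
case/and3P=> upp _ c /(IH _ c)[s sp ->]; exists ((refl p * x)%g :: s) => //=.
by rewrite sp andbT; apply/bruhat_stepP; exists p.
Qed.

(** * Lexicographic order on labels and increasing chains *)

Definition lexlt p q : bool :=
  (p.1 < q.1)%N || (p.1 == q.1) && (p.2 < q.2)%N.

Lemma ltn_ord_eqF (i j : 'I_n) : (i < j)%N -> ((i == j) = false) * ((j == i) = false).
Proof. by move=> ij; rewrite -!(inj_eq val_inj) /= ltn_eqF // gtn_eqF. Qed.

(** A product of two distinct transpositions of three points is one of two 3-cycles; these rules
    rewrite each such product to one of two normal forms. *)
Lemma tperm3_mul (i j k : 'I_n) : i != j -> j != k -> i != k ->
  ((tperm j k * tperm i k = tperm i j * tperm j k)%g *
   (tperm i k * tperm i j = tperm i j * tperm j k)%g *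
   (tperm i k * tperm j k = tperm j k * tperm i j)%g *
   (tperm i j * tperm i k = tperm j k * tperm i j)%g)%type.
Proof.
move=> ij jk ik.
have Jk : (tperm i j ^ tperm j k = tperm i k)%g.
  by rewrite tpermJ tpermL tpermD // eq_sym.
have Ji : (tperm j k ^ tperm i j = tperm i k)%g.
  by rewrite tpermJ tpermR tpermD // eq_sym.
do !split.
- by rewrite -Jk -conjgC.
- by rewrite -Ji conjgE tpermV -!mulgA tperm2 mulg1.
- by rewrite -Jk conjgE tpermV -!mulgA tperm2 mulg1.
- by rewrite -Ji -conjgC.
Qed.

(* Two consecutive labels that share a position live in a copy of S_3, where
   every interval of length 2 has exactly two intermediate elements. The class
   function [f] records that both factorizations generate the same
   connectivity. *)
Lemma diamond x p q : up x p -> up (refl p * x)%g q ->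
  exists p' q', [/\ up x p', up (refl p' * x)%g q',
    (refl q' * (refl p' * x) = refl q * (refl p * x))%g,
    ~~ lexlt p q -> lexlt p' p &
    forall (T : Type) (f : 'I_n -> T),
    (f p.1 = f p.2 /\ f q.1 = f q.2 <-> f p'.1 = f p'.2 /\ f q'.1 = f q'.2)
    /\ (f p.1 = f p.2 -> f p'.1 = f p'.2 -> f q.1 = f q.2)].
Proof.
Ltac three_positions ij jk ik :=
  split; rewrite /up /refl /lexlt /= ?permM ?tpermE
      ?(eqxx, ltn_ord_eqF ij, ltn_ord_eqF jk, ltn_ord_eqF ik) /=;
    [ lia | lia
    | rewrite !mulgA; congr (_ * _)%g;
      by rewrite ?(tperm3_mul (negbT (ltn_ord_eqF ij).1)
                (negbT (ltn_ord_eqF jk).1) (negbT (ltn_ord_eqF ik).1))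
    | lia |
    by move=> T f; split; [split|]; intuition congruence].
case: p q => a b [c d]; rewrite /up /refl /= => /andP[ab xab] /andP[cd].
(* First come the four ways in which the labels can share a position; in each, comparing two
   positions or two values selects the other factorization. *)
rewrite !permM !tpermE; move: cd; have [->|ca] := eqVneq c a.
  move=> ad; rewrite (ltn_ord_eqF ad).
  have [->|db] := eqVneq d b => xbd; first by move: xbd; rewrite ltnNge ltnW.
  have [bd|] := ltnP b d.
    exists (b, d), (a, b); three_positions ab bd ad.
  rewrite leq_eqVlt (inj_eq val_inj) (negPf db) => /= db'.
  exists (a, d), (d, b); three_positions ad db' ab.
have [->|cb] := eqVneq c b.
  move=> bd; rewrite !(ltn_ord_eqF bd) (ltn_ord_eqF (ltn_trans ab bd)) => xad.
  have ad := ltn_trans ab bd.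
  have [xdb|] := ltnP (x d) (x b).
    exists (a, d), (a, b); three_positions ab bd ad.
  rewrite leq_eqVlt (inj_eq val_inj) (inj_eq perm_inj) (ltn_ord_eqF bd) => /= xbd.
  exists (b, d), (a, d); three_positions ab bd ad.
have [->|da] := eqVneq d a.
  move=> ca' xcb; have cb' := ltn_trans ca' ab.
  have [xca|] := ltnP (x c) (x a).
    exists (c, a), (c, b); three_positions ca' ab cb'.
  rewrite leq_eqVlt (inj_eq val_inj) (inj_eq perm_inj) (ltn_ord_eqF ca') => /= xac.
  exists (c, b), (a, b); three_positions ca' ab cb'.
have [->|db] := eqVneq d b => [cb' xca|cd xcd].
  have [ca'|] := ltnP c a.
    exists (c, a), (a, b); three_positions ca' ab cb'.
  rewrite leq_eqVlt (inj_eq val_inj) eq_sym (negPf ca) => /= ac.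
  exists (c, b), (a, c); three_positions ac cb' ab.
(* Disjoint labels commute, so they are simply swapped. *)
exists (c, d), (a, b); split; rewrite /= ?cd ?ab //.
- by rewrite !permM !tpermD // eq_sym.
- rewrite !mulgA; congr (_ * _)%g.
  have -> : tperm c d = (tperm c d ^ tperm a b)%g by rewrite tpermJ !tpermD // eq_sym.
  by rewrite -conjgC tpermJ !tpermD // eq_sym.
- by move: ca db; rewrite /lexlt -!(inj_eq val_inj) /= => /eqP; lia.
- by move=> T f; split; [split|]; intuition congruence.
Qed.

Lemma covers_size x ls ls' : covers x ls -> covers x ls' ->
  chain_end x ls = chain_end x ls' -> size ls = size ls'.
Proof.
move=> /length_chain_end l1 /length_chain_end l2 e.
by apply/(@addnI (len x)); rewrite -l1 -l2 e.
Qed.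

(* In a lexicographically increasing chain to [y] the first label [(a, b)] is
   forced: [a] is the first position at which [x] and [y] differ, and [b] is
   the first position after [a] whose value lies in ]x a, y a]. *)
Lemma increasing_head x p ls : covers x (p :: ls) -> path lexlt p ls ->
  let y := chain_end x (p :: ls) in
  [/\ forall i : 'I_n, (i < p.1)%N -> y i = x i, (x p.2 <= y p.1)%N &
      forall c : 'I_n, (p.1 < c < p.2)%N -> ~~ (x p.1 < x c <= y p.1)%N].
Proof.
elim: ls x p => [|q ls IH] x p /= /and3P[/andP[lt1 lt2] /eqP cov].
  move=> _ _; rewrite permM tpermL; split=> //.
    move=> i ip; rewrite permM tpermE.
    by rewrite (ltn_ord_eqF ip) (ltn_ord_eqF (ltn_trans ip lt1)).
  move=> c pc; apply: contra (cover_empty cov pc) => /andP[-> /=].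
  rewrite leq_eqVlt (inj_eq val_inj) (inj_eq perm_inj).
  by case/andP: pc => _ /ltn_ord_eqF->.
move=> cov' /andP[pq sls]; have [fix1 ge1 emp1] := IH _ _ cov' sls.
rewrite /= in fix1 ge1 emp1; set y := chain_end _ ls in fix1 ge1 emp1 *.
have q1 : (p.1 <= q.1)%N by move: pq => /orP[/ltnW//|/andP[/eqP->]].
have qlt : (q.1 < q.2)%N by case/and3P: cov' => /andP[].
have fix2 (i : 'I_n) : (i < p.1)%N -> y i = x i.
  move=> ip; rewrite fix1 ?(leq_trans ip) // permM tpermE.
  by rewrite (ltn_ord_eqF ip) (ltn_ord_eqF (ltn_trans ip lt1)).
(* Either all later labels start after [p.1], so that the value there is already final, or the next
   label starts at [p.1] too and ends further right. *)
case/orP: pq => [plt|/andP[/eqP pe plt]].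
  have yp : y p.1 = x p.2 by rewrite fix1 // permM tpermL.
  rewrite yp; split=> // c pc; apply: contra (cover_empty cov pc) => /andP[-> /=].
  rewrite leq_eqVlt (inj_eq val_inj) (inj_eq perm_inj).
  by case/andP: pc => _ /ltn_ord_eqF->.
have x1 : (refl p * x)%g q.1 = x p.2 by rewrite -pe permM tpermL.
have up2 : (x p.2 < (refl p * x)%g q.2)%N.
  by rewrite -x1; case/and3P: cov' => /andP[].
rewrite pe; split=> //; first by rewrite -pe.
  exact: ltnW (leq_trans up2 ge1).
move=> c /andP[pc cp]; apply/negP => /andP[xc xcy].
have xcE : (refl p * x)%g c = x c.
  by rewrite permM tpermE pe !(ltn_ord_eqF pc) (ltn_ord_eqF cp).
(* Values below [x p.2] are excluded because the first step is a cover, larger ones by the induction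
   hypothesis for the rest of the chain. *)
have [xcb|xbc] := ltnP (x c) (x p.2).
  have := cover_empty cov (c := c); rewrite pe pc cp xc xcb => /(_ isT).
  by [].
have := emp1 c; rewrite pc (ltn_trans cp plt) xcE x1 xcy andbT => /(_ isT).
by rewrite ltn_neqAle xbc andbT (inj_eq val_inj) (inj_eq perm_inj) (ltn_ord_eqF cp).
Qed.

Lemma increasing_unique x ls ls' : covers x ls -> covers x ls' ->
  sorted lexlt ls -> sorted lexlt ls' -> chain_end x ls = chain_end x ls' ->
  ls = ls'.
Proof.
elim: ls x ls' => [|p ls IH] x [|q ls'] //.
- by move=> c c' _ _ /(covers_size c c').
- by move=> c c' _ _ /(covers_size c c').
move=> c c' s s' e.
have [f1 g1 h1] := increasing_head c s; have [f2 g2 h2] := increasing_head c' s'.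
rewrite -e in f2 g2 h2; move: (chain_end x (p :: ls)) f1 g1 h1 f2 g2 h2.
move=> y f1 g1 h1 f2 g2 h2.
have /andP[/= p12 xp] : up x p by case/and3P: c.
have /andP[/= q12 xq] : up x q by case/and3P: c'.
suff pq : p = q.
  subst q; congr cons; move: c c' e => /= /and3P[_ _ c] /and3P[_ _ c'] e.
  by apply: IH c c' _ _ e; [apply: path_sorted s | apply: path_sorted s'].
(* The chain whose first label starts later would leave the smaller position fixed, while the other
   chain strictly raises the value there. *)
have e1 : p.1 = q.1.
  apply: val_inj; case: (ltngtP p.1 q.1) => // lt.
    by have := leq_trans xp g1; rewrite f2 // ltnn.
  by have := leq_trans xq g2; rewrite f1 // ltnn.
have e2 : p.2 = q.2.
  apply: val_inj; case: (ltngtP p.2 q.2) => // lt.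
    by have := h2 p.2; rewrite -e1 p12 lt xp g1 => /(_ isT).
  by have := h1 q.2; rewrite e1 q12 lt xq g2 => /(_ isT).
by rewrite [p]surjective_pairing [q]surjective_pairing e1 e2.
Qed.

(** * The span of the labels of a chain *)

Section Span.
Variable R : realType.
Implicit Type U : {vspace 'rV[R]_n}.

Definition edge_vec p : 'rV[R]_n := std_basis R p.1 - std_basis R p.2.

Definition edge_span ls : {vspace 'rV[R]_n} := <<[seq edge_vec p | p <- ls]>>%VS.

Lemma edge_span_cons p ls : edge_span (p :: ls) = (<[edge_vec p]> + edge_span ls)%VS.
Proof. by rewrite /edge_span /= span_cons. Qed.

Lemma edge_span_subP ls U :
  reflect (forall p, p \in ls -> edge_vec p \in U) (edge_span ls <= U)%VS.
Proof.
apply: (iffP span_subvP) => [H p pls|H _ /mapP[p pls ->]]; last exact: H.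
by apply: H; apply: map_f.
Qed.

Lemma edge_mem_span ls p : p \in ls -> edge_vec p \in edge_span ls.
Proof. by move=> pls; apply/memv_span/map_f. Qed.

Lemma edge_trans U (i j k : 'I_n) :
  edge_vec (i, j) \in U -> edge_vec (j, k) \in U -> edge_vec (i, k) \in U.
Proof. by move=> ij /(memvD ij); rewrite /edge_vec /= subrKA. Qed.

Lemma edge_sym U (i j : 'I_n) : edge_vec (i, j) \in U -> edge_vec (j, i) \in U.
Proof. by rewrite -memvN /edge_vec opprB. Qed.

(** Turns membership of [edge_vec p] in [U] into an equality of classes, so that the class function
    of [diamond] can be instantiated with it. *)
Definition edge_class U (i : 'I_n) := [set j | edge_vec (i, j) \in U].

Lemma edge_classP U p : edge_class U p.1 = edge_class U p.2 <-> edge_vec p \in U.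
Proof.
case: p => i j /=; split=> [/setP/(_ j)|ij].
  by rewrite !inE => ->; rewrite /edge_vec subrr mem0v.
apply/setP => k; rewrite !inE; apply/idP/idP; last exact: edge_trans.
exact/edge_trans/edge_sym.
Qed.

Lemma diamond_span p q p' q' :
  (forall (T : Type) (f : 'I_n -> T),
    f p.1 = f p.2 /\ f q.1 = f q.2 <-> f p'.1 = f p'.2 /\ f q'.1 = f q'.2) ->
  forall ls, edge_span (p :: q :: ls) = edge_span (p' :: q' :: ls).
Proof.
move=> H ls; apply/eqP; rewrite eqEsubv; apply/andP; split; apply/edge_span_subP.
  have [|] := (H _ (edge_class (edge_span [:: p', q' & ls]))).2.
    by split; apply/edge_classP/edge_mem_span; rewrite !inE eqxx ?orbT.
  move=> /edge_classP h1 /edge_classP h2 r; rewrite !inE => /or3P[/eqP->|/eqP->|] //.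
  by move=> rls; apply: edge_mem_span; rewrite !inE rls !orbT.
have [|] := (H _ (edge_class (edge_span [:: p, q & ls]))).1.
  by split; apply/edge_classP/edge_mem_span; rewrite !inE eqxx ?orbT.
move=> /edge_classP h1 /edge_classP h2 r; rewrite !inE => /or3P[/eqP->|/eqP->|] //.
by move=> rls; apply: edge_mem_span; rewrite !inE rls !orbT.
Qed.

(** The two new steps both raise the length and together raise it by two, so each is a cover. *)
Lemma diamond_covers x p q p' q' ls :
  up x p' -> up (refl p' * x)%g q' ->
  (refl q' * (refl p' * x) = refl q * (refl p * x))%g ->
  covers x [:: p, q & ls] -> covers x [:: p', q' & ls].
Proof.
move=> u1 u2 e /= /and5P[_ /eqP c1 _ /eqP c2 cls].
have [l1 l2] := (length_up u1, length_up u2).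
rewrite u1 u2 e cls !andbT /=; rewrite e c2 c1 in l2 *.
by apply/andP; split; apply/eqP; lia.
Qed.

(** The tail is sorted by induction on the size. If the first label then fails to precede the
    second, a diamond move makes the first label lexicographically smaller, and the inner induction
    on that label applies. *)
Lemma exists_increasing x ls : covers x ls ->
  exists ls', [/\ covers x ls', chain_end x ls' = chain_end x ls,
    sorted lexlt ls' & edge_span ls' = edge_span ls].
Proof.
move eqm : (size ls) => m; elim: m x ls eqm => [|m IHm] x.
  by case=> // _ _; exists [::].
(* Since [p.2 < n], the number [p.1 * n + p.2] is strictly increasing for [lexlt]. *)
case=> // p ls [eqm]; move eqk : (p.1 * n + p.2)%N => k.
elim/ltn_ind: k p ls eqm eqk => k IHk p ls eqm eqk.
move=> c; have /and3P[upp covp /(IHm _ _ eqm)[ls1 [c1 e1 s1 sp1]]] := c.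
have c' : covers x (p :: ls1) by rewrite /= upp covp.
have e' : chain_end x (p :: ls1) = chain_end x (p :: ls) by rewrite /= e1.
have sp' : edge_span (p :: ls1) = edge_span (p :: ls).
  by rewrite !edge_span_cons sp1.
rewrite -e' -sp'; have [sz] := covers_size c' c e'; rewrite -sz in eqm.
case: ls1 {e1 c1 sp1 e' sp' sz} s1 c' eqm => [|q r] s1 c' eqm.
  by exists [:: p].
have [pq|npq] := boolP (lexlt p q); first by exists [:: p, q & r]; rewrite /= pq.
have upq : up (refl p * x)%g q by case/and5P: c'.
have [p' [q' [u1 u2 e lt cl]]] := diamond upp upq.
have cov' := diamond_covers u1 u2 e c'.
have [] := IHk (p'.1 * n + p'.2)%N _ p' (q' :: r) _ erefl cov' => //.
  have := lt npq; rewrite -eqk /lexlt => /orP[|/andP[/eqP-> //]]; last by lia.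
  move=> lt1; have := ltn_ord p'.2; nia.
move=> ls' [cc ee ss pp]; exists ls'; split=> //; first by rewrite ee /= e.
by rewrite pp; apply/esym/diamond_span => T f; case: (cl T f).
Qed.

Lemma edge_span_unique x ls ls' : covers x ls -> covers x ls' ->
  chain_end x ls = chain_end x ls' -> edge_span ls = edge_span ls'.
Proof.
move=> /exists_increasing[l1 [c1 e1 s1 <-]] /exists_increasing[l2 [c2 e2 s2 <-]] e.
by congr edge_span; apply: increasing_unique c1 c2 s1 s2 _; rewrite e1 e2.
Qed.

(** Each reflection of the chain moves a position along one edge. Applied to a chain from [x] to
    [refl p * x], this recovers [edge_vec p]. *)
Lemma edge_span_chain_end x ls (i : 'I_n) :
  std_basis R i - std_basis R ((chain_end x ls * x^-1)%g i) \in edge_span ls.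
Proof.
elim/last_ind: ls i => [|ls p IH] i; first by rewrite /= mulgV perm1 subrr mem0v.
rewrite /chain_end foldl_rcons -/(chain_end x ls) -mulgA permM.
have sub : (edge_span ls <= edge_span (rcons ls p))%VS.
  apply/edge_span_subP => q qls; apply: edge_mem_span.
  by rewrite mem_rcons inE qls orbT.
have rp : edge_vec p \in edge_span (rcons ls p).
  by apply: edge_mem_span; rewrite mem_rcons mem_head.
apply: (@edge_trans _ i (refl p i)); last exact: subvP sub _ (IH _).
case: tpermP => [->|->|_ _]; last by rewrite /edge_vec subrr mem0v.
  by rewrite -surjective_pairing.
by apply: edge_sym; rewrite -surjective_pairing.
Qed.

(** * The span of all reflections in an interval, and the weight cone *)

Definition reflection_span x y : {vspace 'rV[R]_n} :=
  edge_span [seq p <- enum {: 'I_n * 'I_n} | up x p && bruhat_le (refl p * x)%g y].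

Lemma reflection_mem_span x y p : up x p -> bruhat_le (refl p * x)%g y ->
  edge_vec p \in reflection_span x y.
Proof. by move=> u le; apply: edge_mem_span; rewrite mem_filter u le mem_enum. Qed.

Lemma edge_span_cat ls1 ls2 :
  edge_span (ls1 ++ ls2) = (edge_span ls1 + edge_span ls2)%VS.
Proof. by rewrite /edge_span map_cat span_cat. Qed.

Lemma reflection_span_chain x ls : covers x ls ->
  reflection_span x (chain_end x ls) = edge_span ls.
Proof.
move=> c; apply/eqP; rewrite eqEsubv; apply/andP; split.
  apply/edge_span_subP => p; rewrite mem_filter => /andP[/andP[upp]].
  case/bruhat_leP=> ls2 c2 e2 _; have [ls1 c1 e1] := up_covers upp.
  (* The chain is exchanged for one passing through [refl p * x]. *)
  rewrite -(@edge_span_unique x (ls1 ++ ls2)) //.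
  - rewrite edge_span_cat; apply: subvP (addvSl _ _) _ _.
    have := edge_span_chain_end x ls1 p.1.
    by rewrite e1 mulgK /refl tpermL.
  - by rewrite covers_cat c1 e1.
  - by rewrite chain_end_cat e1.
elim: ls x c => [|p ls IH] x /=; first by rewrite /edge_span span_nil sub0v.
case/and3P=> upp _ c; set y := chain_end _ ls.
have py : bruhat_le (refl p * x)%g y by apply/bruhat_leP; exists ls.
have pxy := reflection_mem_span upp py.
rewrite edge_span_cons subv_add -memvE pxy /=.
apply: subv_trans (IH _ c) _; apply/edge_span_subP => q.
rewrite mem_filter => /andP[/andP[upq le] _].
(* The label [q] lives above [refl p * x], not above [x]. The diamond supplies a label [p'] at [x],
   still below [y], such that [edge_vec p] and [edge_vec p'] force [edge_vec q] into the span. *)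
have [p' [q' [u1 u2 e _ conn]]] := diamond upp upq.
have [_ cl] := conn _ (edge_class (reflection_span x y)).
apply/edge_classP/cl; apply/edge_classP => //.
apply: reflection_mem_span u1 _.
apply: connect_trans (connect1 _) le; apply/bruhat_stepP; exists q' => //.
Qed.

Lemma cone_dimE (s : seq 'rV[R]_n) : cone_dim (cone s) = \dim <<s>>.
Proof.
rewrite /cone_dim; case: ex_minnP => d /asboolP[U [sU <-]] min.
apply/eqP; rewrite eqn_leq; apply/andP; split.
  apply: min; apply/asboolP; exists <<s>>%VS; split=> // _ [c [_ ->]].
  by apply: memv_suml => i _; rewrite memvZ // memv_span // mem_nth.
apply/dimvS/span_subvP => v /(nthP 0)[i lti <-]; apply: sU.
(* Indicator coefficients show that each generator lies in the cone. *)
exists (fun j => (val j == i)%:R); split=> [j|]; first exact: ler0n.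
rewrite (bigD1 (Ordinal lti)) //= eqxx scale1r big1 ?addr0 // => j.
by rewrite -(inj_eq val_inj) /= => /negPf->; rewrite scale0r.
Qed.

Lemma std_basis_perm x (i : 'I_n) :
  std_basis R i *m perm_mx x = std_basis R (x i).
Proof. by rewrite -rowE; apply/rowP => j; rewrite !mxE eqxx eq_sym. Qed.

(* The weight cone lives on values; permuting coordinates by [x] moves it to
   positions. *)
Lemma weight_cone_dim x y :
  cone_dim (@weight_cone R n x y) = \dim (reflection_span x y).
Proof.
rewrite cone_dimE; pose f : 'Hom('rV[R]_n, 'rV[R]_n) := linfun (mulmxr (perm_mx x)).
have fE v : f v = v *m perm_mx x by rewrite lfunE.
have -> : \dim (reflection_span x y) = \dim (f @: reflection_span x y)%VS.
  apply/esym/limg_dim_eq/eqP; rewrite -subv0; apply/subvP => v.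
  rewrite memv_cap memv_ker fE => /andP[_ /eqP v0]; rewrite memv0.
  by rewrite -(mulmx1 v) -perm_mx1 -(mulgV x) perm_mxM mulmxA v0 mul0mx.
rewrite limg_span; congr (\dim _); apply: eq_span => v.
have reflE p : (x * tperm (x p.1) (x p.2) = refl p * x)%g.
  by rewrite -tpermJ -conjgC.
apply/mapP/mapP => [[q]|[_ /mapP[p pin ->] ->]].
  rewrite mem_filter mem_enum inE => /andP[le /andP[xq q2]] ->.
  (* A diagram cell (i, j) corresponds to the pair of positions j and [x^-1] i. *)
  exists (edge_vec (q.2, (x^-1)%g q.1)); last first.
    by rewrite fE mulmxBl !std_basis_perm /= permKV.
  apply/map_f; rewrite mem_filter mem_enum andbT /up /= q2 permKV xq /=.
  by rewrite -reflE /= permKV.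
move: pin; rewrite mem_filter => /andP[/andP[/andP[lt xlt] le] _].
exists (x p.2, p.1); last by rewrite fE mulmxBl !std_basis_perm.
by rewrite mem_filter mem_enum inE /= permK lt xlt reflE le.
Qed.

Lemma KL_toric_chain x ls : covers x ls ->
  KL_toric R x (chain_end x ls) <-> \dim (edge_span ls) = size ls.
Proof.
move=> c; rewrite /KL_toric /KL_complexity /KL_dim weight_cone_dim.
rewrite reflection_span_chain // length_chain_end //; lia.
Qed.

End Span.

(** * From chains of permutations to sequences of labels *)

Lemma chain_edge_cons x z c (a b : 'I_n) :
  chain_edge x (z :: c) a b = (z == tperm a b * x)%g || chain_edge z c a b.
Proof.
(* The head of the chain doubles as the default of [nth]; all indices are in range, so changing it
   is harmless. *)
have nthE s i : (i < size s)%N -> nth x s i = nth z s i.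
  exact: set_nth_default.
apply/existsP/orP => [[[[|i] /= lt]]|[zE|/existsP[[i lt] E]]].
- by left.
- move=> E; right; apply/existsP; exists (Ordinal (lt : (i < size c)%N)).
  by move: E; rewrite /= !nthE //; apply: ltnW.
- by exists ord0.
exists (Ordinal (lt : (i.+1 < size (z :: c))%N)).
by move: E; rewrite /= !nthE //; apply: ltnW.
Qed.

Lemma bruhat_cover_label x z :
  bruhat_cover x z -> exists2 p, covers x [:: p] & z = (refl p * x)%g.
Proof.
case/andP=> /andP[_ /bruhat_leP[ls c e]] /eqP l.
have := length_chain_end c; rewrite e l -addn1 => /addnI.
case: ls c e => [|p [|]] //= c e _; exists p => //.
Qed.

Lemma tperm_up_eq x p (a b : 'I_n) : up x p ->
  (refl p * x == tperm a b * x)%g = ((a, b) == p) || ((b, a) == p).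
Proof.
case: p => i j /andP[/= ij _]; rewrite (inj_eq (mulIg x)) !xpair_eqE /refl /=.
apply/eqP/orP => [E|[/andP[/eqP-> /eqP->]|/andP[/eqP-> /eqP->]]] //; last first.
  by rewrite tpermC.
have := congr1 (fun s : 'S_n => s i) E; rewrite /= tpermL.
case: tpermP => [-> ->|-> ->|_ _ ji]; rewrite ?eqxx; [by left|by right|].
by move: ij; rewrite ji ltnn.
Qed.

Lemma is_chain_labels x y c : is_chain x y c ->
  exists ls, [/\ covers x ls, chain_end x ls = y &
    forall a b, chain_edge x c a b = ((a, b) \in ls) || ((b, a) \in ls)].
Proof.
elim: c x => [|z c IH] x /andP[/=].
  by move=> _ /eqP->; exists [::]; split=> // a b; apply/existsP => -[[]].
case/andP=> /bruhat_cover_label[p cp zE] pc lE.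
have [|ls [cl el edge]] := IH z; first by rewrite /is_chain pc.
exists (p :: ls); split; rewrite /= -?zE //.
  by move: cp; rewrite /= -zE cl.
move=> a b; rewrite chain_edge_cons edge zE.
have upp : up x p by case/and3P: cp.
by rewrite (tperm_up_eq _ _ upp) !inE orbACA.
Qed.

End BruhatChains.

(** * Alternating cycles *)

Section ComponentsOfSpans.
Variables (R : realType) (n : nat).
Implicit Types (e : rel 'I_n) (ls : seq ('I_n * 'I_n)).

(** The graph is undirected, whereas the labels of a chain are ordered pairs. *)
Definition labelled_by e ls :=
  forall a b, e a b = ((a, b) \in ls) || ((b, a) \in ls).

Lemma connect_labelled_equiv e ls : labelled_by e ls ->
  equivalence_rel (connect e).
Proof.
move=> el; have sym : connect_sym e.
  by apply: sym_connect_sym => a b; rewrite !el orbC.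
move=> a b c; split=> [|ab]; first exact: connect0.
apply/idP/idP; last exact: connect_trans.
by apply: connect_trans; rewrite sym.
Qed.

Lemma connect_edge_span e ls (a b : 'I_n) : labelled_by e ls ->
  connect e a b -> edge_vec R (a, b) \in edge_span R ls.
Proof.
move=> el /connectP[c cp ->]; elim: c a cp => [|d c IH] a /=.
  by rewrite /edge_vec subrr mem0v.
case/andP=> ad /IH; apply: edge_trans.
by move: ad; rewrite el => /orP[|] dls; [|apply: edge_sym]; apply: edge_mem_span.
Qed.

Lemma edge_span_sum0 e ls (f : 'rV[R]_n) (a : 'I_n) : labelled_by e ls ->
  f \in edge_span R ls -> \sum_(b | connect e a b) f 0 b = 0.
Proof.
(* The coordinate sum over the component of [a], as a linear map; it kills every edge vector because
   both ends of an edge lie in one component. *)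
move=> el; pose g : 'Hom('rV[R]_n, 'rV[R]_1) :=
  linfun (mulmxr (\col_b (connect e a b)%:R)).
have gE h : g h = (\sum_(b | connect e a b) h 0 b)%:M.
  apply/rowP => i; rewrite lfunE !mxE ord1 eqxx mulr1n [RHS]big_mkcond.
  by apply: eq_bigr => b _; rewrite mxE; case: ifP; rewrite ?mulr1 ?mulr0.
suff sub : (edge_span R ls <= lker g)%VS.
  move/(subvP sub); rewrite memv_ker gE => /eqP/rowP/(_ 0).
  by rewrite !mxE eqxx mulr1n.
have std h : \sum_(b | connect e a b) std_basis R h 0 b = (connect e a h)%:R.
  case: (boolP (connect e a h)) => ah.
    rewrite (bigD1 h) //= big1 ?addr0 => [|b /andP[_ bh]]; rewrite mxE eqxx ?eqxx //.
    by rewrite (negPf bh).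
  rewrite big1 // => b ab; rewrite mxE eqxx /=; case: eqP => // bh.
  by rewrite -bh ab in ah.
apply/edge_span_subP => -[i j] ijls; rewrite memv_ker gE /edge_vec.
rewrite (eq_bigr (fun b => std_basis R i 0 b - std_basis R j 0 b)) => [|b _]; last first.
  by rewrite !mxE.
rewrite sumrB !std.
have /(connect1) ij : e i j by rewrite el ijls.
have -> : connect e a i = connect e a j.
  apply/idP/idP => h; first exact: connect_trans h ij.
  by apply: connect_trans h _; apply: connect1; rewrite el ijls orbT.
by rewrite subrr raddf0.
Qed.

Lemma component_connect e ls B (a b : 'I_n) : labelled_by e ls ->
  B \in components e -> a \in B -> b \in B -> connect e a b.
Proof.
move=> el /imsetP[c _ ->]; rewrite !inE /= => ca cb.
by have [_ /(_ ca) <-] := connect_labelled_equiv el c a b.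
Qed.

Lemma component_class e (a : 'I_n) :
  [set b in [set: 'I_n] | connect e a b] \in components e.
Proof. by apply/imsetP; exists a. Qed.

Variables (e1 e2 : rel 'I_n) (l1 l2 : seq ('I_n * 'I_n)).
Hypotheses (el1 : labelled_by e1 l1) (el2 : labelled_by e2 l2).

Lemma alternating_cycle_capv : alternating_cycle e1 e2 ->
  (edge_span R l1 :&: edge_span R l2)%VS != 0%VS.
Proof.
case=> k [a [B [C [k0 inj comp mem]]]].
pose f : 'rV[R]_n := \sum_(i < k)
  (std_basis R (a (2 * i)%N) - std_basis R (a (2 * i).+1)).
suff [fcap f0] : f \in (edge_span R l1 :&: edge_span R l2)%VS /\ f != 0.
  by apply: contra f0 => /eqP cap0; move: fcap; rewrite cap0 memv0.
split; last first.
  (* As the [a i] are distinct, the coordinate at [a 0] is 1. *)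
  apply/eqP => /rowP/(_ (a 0%N)); rewrite summxE (bigD1 (Ordinal k0)) //=.
  rewrite big1 => [|i i0]; rewrite !mxE /= ?muln0 ?eqxx /=.
    case: eqP => [/inj h|_]; first by exfalso; move: h; lia.
    by rewrite subr0 addr0 => /eqP; rewrite oner_eq0.
  have lti := ltn_ord i; move: i0; rewrite -(inj_eq val_inj) /= => /eqP i0.
  case: eqP => [/inj h|_]; first by exfalso; move: h; lia.
  case: eqP => [/inj h|_]; first by exfalso; move: h; lia.
  by rewrite subrr.
rewrite memv_cap; apply/andP; split; last first.
  apply: memv_suml => i _; apply: (@connect_edge_span e2) => //.
  have [_ Ci] := comp _ (ltn_ord i); have [] := mem _ (ltn_ord i).
  rewrite !inE => /andP[_ h] /andP[h' _]; exact: component_connect el2 Ci h h'.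
have inj_next : injective (@ordS k) by apply: ordS_inj.
(* For the first graph the terms are regrouped by a cyclic shift, pairing [a (2 * i).+1] with the
   next even-indexed vertex. *)
rewrite /f sumrB (reindex_inj inj_next) /= -sumrB.
apply: memv_suml => i _; apply: (@connect_edge_span e1) => //.
have lt : (i.+1 %% k < k)%N by rewrite ltn_mod.
have [Bi _] := comp _ lt; have [] := mem _ lt; have [_] := mem _ (ltn_ord i).
rewrite !inE => /andP[_ h] /andP[h' _] _; exact: component_connect el1 Bi h' h.
Qed.

(** The flag [t] records which graph the first step uses; for [t = true] the walk is rotated by one
    vertex, so that it starts with a step of [e2], inside a component [C]. *)
Lemma closed_walk_alternating (k : nat) (b : nat -> 'I_n) (t : bool) :
  (0 < k)%N ->
  (forall i j, (i < 2 * k)%N -> (j < 2 * k)%N -> b i = b j -> i = j) ->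
  (forall m, (m < 2 * k)%N ->
     connect (if odd m (+) t then e1 else e2) (b m) (b (m.+1 %% (2 * k))%N)) ->
  alternating_cycle e1 e2.
Proof.
move=> k0; wlog -> : b t / t = false => [H inj step|].
  case: t step => step; last exact: (H b false).
  pose b' m := b (m.+1 %% (2 * k))%N.
  have lt m : (m.+1 %% (2 * k) < 2 * k)%N by rewrite ltn_mod; lia.
  apply: (H b' false) => // [i j li lj /inj|m _].
    move=> /(_ (lt _) (lt _)) /eqP; rewrite -addn1 -[j.+1]addn1 eqn_modDr.
    by rewrite !modn_small // => /eqP.
  have := step _ (lt m); rewrite /b' addbF addbT.
  have -> : odd (m.+1 %% (2 * k)) = ~~ odd m.
    by rewrite odd_mod //= oddM.
  by rewrite negbK.
move=> inj step.
exists k, b, (fun i => [set c in [set: 'I_n] | connect e1 (b (2 * i)%N) c]),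
  (fun i => [set c in [set: 'I_n] | connect e2 (b (2 * i)%N) c]).
split=> // [i _|i ik]; first by split; apply: component_class.
rewrite !inE /= !connect0; split=> //; apply/andP; split.
  have /= := step (2 * i)%N; rewrite oddM /= modn_small; last by lia.
  by apply; lia.
have /= := step (2 * i).+1; rewrite oddM /=.
have -> : ((2 * i).+2 %% (2 * k) = 2 * (i.+1 %% k))%N.
  by rewrite muln_modr; congr (_ %% _)%N; lia.
have [_ /(_ _)] := connect_labelled_equiv el1
  (b (2 * i).+1) (b (2 * (i.+1 %% k)))%N (b (2 * i).+1).
move=> E /(_ _)/E <-; first exact: connect0.
by lia.
Qed.

Lemma capv_alternating_cycle :
  (edge_span R l1 :&: edge_span R l2)%VS != 0%VS -> alternating_cycle e1 e2.
Proof.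
move=> /eqP cap0.
have [f] : exists2 f, f \in (edge_span R l1 :&: edge_span R l2)%VS & f != 0.
  exists (vpick (edge_span R l1 :&: edge_span R l2)%VS); first exact: memv_pick.
  by rewrite vpick0; apply/eqP.
rewrite memv_cap => /andP[f1 f2] f0.
have [a0 fa0] : exists a, f 0 a != 0.
  apply/existsP; apply: contraNT f0 => /existsPn H.
  by apply/eqP/rowP => a; rewrite mxE; apply/eqP; have := H a; rewrite negbK.
pose E (t : bool) := connect (if t then e1 else e2).
have Eequiv t : equivalence_rel (E t).
  by case: t; [apply: connect_labelled_equiv el1|apply: connect_labelled_equiv el2].
have Esum t a : \sum_(b | E t a b) f 0 b = 0.
  by case: t; [apply: edge_span_sum0 el1 f1|apply: edge_span_sum0 el2 f2].
(* Another support vertex in the class of [a]: it exists because the coordinates of [f] over the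
   class sum to 0. The default [a] is never reached from the support. *)
pose next t a := odflt a [pick b | [&& E t a b, b != a & f 0 b != 0]].
have nextP t a : f 0 a != 0 -> [&& E t a (next t a), next t a != a & f 0 (next t a) != 0].
  move=> fa; rewrite /next; case: pickP => //= no; case/negP: fa.
  have := Esum t a; rewrite (bigD1 a) /=; last by have [] := Eequiv t a a a.
  rewrite big1 ?addr0 => [->//|b /andP[Eab ba]].
  by have := no b; rewrite Eab ba /= => /negbFE/eqP.
pose fix w m := if m is m'.+1 then next (odd m') (w m') else a0.
have fw m : f 0 (w m) != 0.
  by elim: m => //= m IH; case/and3P: (nextP (odd m) _ IH).
have Ew m : E (odd m) (w m) (w m.+1) by case/and3P: (nextP (odd m) _ (fw m)).
have wS m : w m.+1 != w m by case/and3P: (nextP (odd m) _ (fw m)).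
(* The first return to an earlier vertex: all vertices visited before time [j] are distinct. *)
have [j [[i ij wij] minj]] : exists j, (exists2 i, (i < j)%N & w i = w j) /\
    forall i' j', (i' < j' < j)%N -> w i' <> w j'.
  have rep : exists j, [exists i : 'I_j, w i == w j].
    have : ~~ injectiveb (fun m : 'I_n.+1 => w m).
      by apply/negP => /injectiveP/leq_card; rewrite !card_ord ltnn.
    case/injectivePn => i [j ij wij].
    wlog lt : i j ij wij / (i < j)%N => [H|]; last first.
      by exists j; apply/existsP; exists (Ordinal lt); apply/eqP.
    case: (ltngtP i j) => [lt|lt|/val_inj e]; [exact: H lt| |].
      by apply: (H j i); rewrite // eq_sym.
    by rewrite e eqxx in ij.
  case: (ex_minnP rep) => j /existsP[i /eqP wij] minj; exists j; split; first by exists i.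
  move=> i' j' /andP[lt lt'] w'.
  have /minj : [exists i0 : 'I_j', w i0 == w j'].
    by apply/existsP; exists (Ordinal lt); apply/eqP.
  by rewrite leqNgt lt'.
have injw s : forall i' j', (s + i' < j)%N -> (s + j' < j)%N ->
    w (s + i')%N = w (s + j')%N -> i' = j'.
  move=> i' j' li lj e; case: (ltngtP i' j') => // lt.
    by case: (minj (s + i')%N (s + j')%N) => //; rewrite ltn_add2l lt.
  by case: (minj (s + j')%N (s + i')%N) => //; rewrite ltn_add2l lt.
have d2 := odd_double_half (j - i).
have dE : (j - i)./2.*2 = (2 * (j - i)./2)%N by rewrite -mul2n.
set k := (j - i)./2 in d2 dE.
case odd_ji : (odd (j - i)) in d2.
  (* Both steps at the repeated vertex are in the same graph: drop it. *)
  have k0 : (0 < k)%N.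
    rewrite lt0n; apply/eqP => k0; have ji : j = i.+1 by lia.
    by case/negP: (wS i); rewrite -ji wij.
  apply: (@closed_walk_alternating k (fun m => w (i.+1 + m)%N) (odd i.+1)) => //.
    by move=> i' j' li lj; apply: injw; lia.
  move=> m mk; rewrite -oddD addnC -/(E _ _ _).
  have [lt|ge] := ltnP m.+1 (2 * k); first by rewrite modn_small // addnS.
  have mE : m.+1 = (2 * k)%N by lia.
  rewrite mE modnn addn0.
  have jE : j = (i.+1 + m).+1 by lia.
  have oE : odd (i.+1 + m) = odd i.
    by have -> : (i.+1 + m = i + 2 * k)%N by [lia]; rewrite oddD oddM addbF.
  have := Ew (i.+1 + m)%N; rewrite -jE -wij oE.
  have [_ H] := Eequiv (odd i) (w (i.+1 + m)%N) (w i) (w i.+1).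
  by move=> /H ->; apply: Ew.
(* With [j - i] even, the walk from [i] to [j] already alternates when closed up. *)
apply: (@closed_walk_alternating k (fun m => w (i + m)%N) (odd i)).
- by lia.
- by move=> i' j' li lj; apply: injw; lia.
move=> m mk; rewrite -oddD addnC -/(E _ _ _).
have [lt|ge] := ltnP m.+1 (2 * k); first by rewrite modn_small // addnS.
have mE : m.+1 = (2 * k)%N by lia.
rewrite mE modnn addn0 wij; have -> : j = (i + m).+1 by lia.
exact: Ew.
Qed.

End ComponentsOfSpans.

Theorem lemma3p23 (R : realType) (n : nat) (u v w : 'S_n)
    (C1 C2 : seq 'S_n)
    (huv : bruhat_le u v) (hvw : bruhat_le v w)
    (hC1 : is_chain u v C1) (hC2 : is_chain v w C2)
    (Tuv : KL_toric R u v) (Tvw : KL_toric R v w) :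
  KL_toric R u w <-> ~ alternating_cycle (chain_edge u C1) (chain_edge v C2).
Proof.
have [l1 [c1 e1 el1]] := is_chain_labels hC1.
have [l2 [c2 e2 el2]] := is_chain_labels hC2.
have c12 : covers u (l1 ++ l2) by rewrite covers_cat c1 e1.
have e12 : chain_end u (l1 ++ l2) = w by rewrite chain_end_cat e1.
have d1 : \dim (edge_span R l1) = size l1 by apply/(KL_toric_chain R c1); rewrite e1.
have d2 : \dim (edge_span R l2) = size l2 by apply/(KL_toric_chain R c2); rewrite e2.
(* The concatenated chain has independent labels exactly when the dimensions of the two spans add
   up. *)
have d12 : KL_toric R u w <-> (edge_span R l1 :&: edge_span R l2)%VS = 0%VS.
  rewrite -e12 (KL_toric_chain R c12) edge_span_cat size_cat -d1 -d2 -dimv_sum_cap.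
  rewrite -[X in X = _ <-> _]addn0; split=> [/addnI/esym/eqP|->]; last by rewrite dimv0.
  by rewrite dimv_eq0 => /eqP.
rewrite d12; split=> [/eqP cap0 /(alternating_cycle_capv R el1 el2)|no].
  by rewrite cap0.
by apply/eqP; apply: contra_notT no; apply: capv_alternating_cycle el1 el2.
Qed.
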